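(* Let $L_{\mathrm{Rect}}$ and $L_{\mathrm{Evil}}$ be the languages defined in the context. Define $b:L_{\mathrm{Rect}}\to L_{\mathrm{Evil}}$ on a word $w$ by (1) substituting $2\mapsto p$, $u\mapsto q$, $d\mapsto r$, $1\mapsto s$, and then (2) if the resulting word contains an $r$, reversing the prefix lying to the left of its rightmost $r$. Then $b$ is a well-defined, length-preserving bijection $L_{\mathrm{Rect}}\to L_{\mathrm{Evil}}$, whose inverse is given by (1) reversing the prefix to the left of the rightmost $r$ (if any), and then (2) substituting $p\mapsto 2$, $q\mapsto u$, $r\mapsto d$, $s\mapsto 1$.
   Context: Permutations are written in one-line form; $e_0$ is the empty permutation. For $\pi\in S_n$ and $1\le i,j\le n+1$, $\rho_{i,j}(\pi)\in S_{n+1}$ is obtained by increasing by $1$ every entry $\ge i$ and inserting value $i$ at position $j$; for $a>b$, $\gamma_{a,b}(\pi)$ moves the entry at position $a$ to position $b$. A word $x_m\cdots x_1$ stands for the composition of the corresponding operators with the rightmost applied first, and a language consists of the nonempty words for which the composition applied to $e_0$ is defined (each operator applied within its domain). Rectangular permutations avoid $2413,2431,4213,4231$. On them: $\psi_1=\rho_{1,1}$ (domain: all rectangular, including $e_0$); $\psi_2=\rho_{1,2}$ and $\psi_u(\pi)=\rho_{\pi_1,1}(\pi)$ (domain: rectangular of size $\ge1$ with $\pi_1\neq1$); $\psi_d(\pi)=\rho_{\pi_1+1,1}(\pi)$ (domain: rectangular of size $\ge1$). $L_{\mathrm{Rect}}$ is the resulting language over $\{1,2,u,d\}$. Evil-avoiding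 permutations avoid $2413,4132,4213,3214$. A recoil of $\pi\in S_n$ is $i$ with $\pi^{-1}_i>\pi^{-1}_{i+1}$. $\pi\in S_n$ is $(a,b)$-sandwiched ($a\ge0,b\ge1$) if $(\pi_1,\dots,\pi_a)=(1,\dots,a)$ and $(\pi_{n-b+1},\dots,\pi_n)=(a+1,\dots,a+b)$. On evil-avoiding permutations: $\psi_p=\rho_{1,1}$ (domain: non-identity); $\psi_q$ (domain: non-identity) with $\psi_q(\pi)=\gamma_{n-b+2,a+2}(\rho_{t+1,1}(\pi))$ if $\pi$ is $(a,b)$-sandwiched and $\rho_{t+1,1}(\pi)$ otherwise, where $t$ is the smallest recoil of $\pi$; $\psi_r(\pi)=\rho_{1,n+1}(\pi)$ (domain: size $\ge1$); $\psi_s(\pi)=\rho_{\pi_n+1,n+1}(\pi)$, $\psi_s(e_0)=[1]$ (domain: identity permutations $e_n$, $n\ge0$, and those $\pi\in S_n$ with $(\pi_{n-t+1},\dots,\pi_n)=(1,\dots,t)$ for some $t\ge1$). $L_{\mathrm{Evil}}$ is the resulting language over $\{p,q,r,s\}$. *)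

(* Defs.v *)
From mathcomp Require Import all_boot.
Set Implicit Arguments.
Unset Strict Implicit.
Unset Printing Implicit Defensive.

Definition is_perm (pi : seq nat) : Prop := perm_eq pi (iota 1 (size pi)).

Definition same_order (s p : seq nat) : bool :=
  (size s == size p) &&
  all (fun i => all (fun j => (nth 0 s i < nth 0 s j) == (nth 0 p i < nth 0 p j))
                    (iota 0 (size p))) (iota 0 (size p)).

(** pi contains the pattern p (entries of pi are distinct, so subsequences
    of values correspond to choices of positions). *)
Definition contains (pi p : seq nat) : Prop :=
  exists s, subseq s pi /\ same_order s p.

Definition avoids (pi p : seq nat) : Prop := ~ contains pi p.

Definition rectangular (pi : seq nat) : Prop :=
  is_perm pi /\ avoids pi [:: 2; 4; 1; 3] /\ avoids pi [:: 2; 4; 3; 1]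
  /\ avoids pi [:: 4; 2; 1; 3] /\ avoids pi [:: 4; 2; 3; 1].

Definition evil_avoiding (pi : seq nat) : Prop :=
  is_perm pi /\ avoids pi [:: 2; 4; 1; 3] /\ avoids pi [:: 4; 1; 3; 2]
  /\ avoids pi [:: 4; 2; 1; 3] /\ avoids pi [:: 3; 2; 1; 4].

(** rho_{i,j}: increase every entry >= i by 1, insert value i at position j
    (positions are 1-based). *)
Definition rho (i j : nat) (pi : seq nat) : seq nat :=
  let s := map (fun x => if i <= x then x.+1 else x) pi in
  take j.-1 s ++ i :: drop j.-1 s.

Definition gamma (a b : nat) (pi : seq nat) : seq nat :=
  let x := nth 0 pi a.-1 in
  let s := take a.-1 pi ++ drop a pi in
  take b.-1 s ++ x :: drop b.-1 s.

Definition identity_perm (pi : seq nat) : Prop := pi = iota 1 (size pi).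

Definition recoil (pi : seq nat) (i : nat) : bool :=
  (1 <= i < size pi) && (index i.+1 pi < index i pi).

Definition smallest_recoil (pi : seq nat) (t : nat) : Prop :=
  recoil pi t /\ forall i, i < t -> ~~ recoil pi i.

Definition sandwiched (pi : seq nat) (a b : nat) : Prop :=
  1 <= b /\ take a pi = iota 1 a /\ drop (size pi - b) pi = iota a.+1 b.

Inductive rletter := R1 | R2 | Ru | Rd.

Definition stepR (x : rletter) (pi pi' : seq nat) : Prop :=
  match x with
  | R1 => rectangular pi /\ pi' = rho 1 1 pi
  | R2 => rectangular pi /\ 0 < size pi /\ head 0 pi <> 1 /\ pi' = rho 1 2 pi
  | Ru => rectangular pi /\ 0 < size pi /\ head 0 pi <> 1 /\ pi' = rho (head 0 pi) 1 pi
  | Rd => rectangular pi /\ 0 < size pi /\ pi' = rho (head 0 pi).+1 1 pi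
  end.

(** A word [x_m; ...; x_1] (leftmost letter first); the rightmost letter is
    applied first to e_0 = [::]. [reachR w pi] : the composition is defined
    and yields pi. *)
Inductive reachR : seq rletter -> seq nat -> Prop :=
  | reachR0 : reachR [::] [::]
  | reachRS x w pi pi' : reachR w pi -> stepR x pi pi' -> reachR (x :: w) pi'.

Definition L_Rect (w : seq rletter) : Prop := w <> [::] /\ exists pi, reachR w pi.

Inductive eletter := Ep | Eq | Er | Es.

Definition stepE (x : eletter) (pi pi' : seq nat) : Prop :=
  match x with
  | Ep => evil_avoiding pi /\ ~ identity_perm pi /\ pi' = rho 1 1 pi
  | Eq => evil_avoiding pi /\ ~ identity_perm pi /\
          exists t, smallest_recoil pi t /\
            ((exists a b, sandwiched pi a b /\
                 pi' = gamma (size pi - b + 2) (a + 2) (rho t.+1 1 pi))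
             \/ ((forall a b, ~ sandwiched pi a b) /\ pi' = rho t.+1 1 pi))
  | Er => evil_avoiding pi /\ 0 < size pi /\ pi' = rho 1 (size pi).+1 pi
  | Es => evil_avoiding pi /\
          (identity_perm pi \/
           exists t, 1 <= t /\ t <= size pi /\ drop (size pi - t) pi = iota 1 t) /\
          pi' = (if pi is [::] then [:: 1] else rho (last 0 pi).+1 (size pi).+1 pi)
  end.

Inductive reachE : seq eletter -> seq nat -> Prop :=
  | reachE0 : reachE [::] [::]
  | reachES x w pi pi' : reachE w pi -> stepE x pi pi' -> reachE (x :: w) pi'.

Definition L_Evil (w : seq eletter) : Prop := w <> [::] /\ exists pi, reachE w pi.

Definition subst_RE (x : rletter) : eletter :=
  match x with R2 => Ep | Ru => Eq | Rd => Er | R1 => Es end.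

Definition subst_ER (x : eletter) : rletter :=
  match x with Ep => R2 | Eq => Ru | Er => Rd | Es => R1 end.

Definition is_r (x : eletter) : bool := if x is Er then true else false.

Definition rev_before_last_r (v : seq eletter) : seq eletter :=
  if has is_r v then
    let k := size v - (find is_r (rev v)).+1 in rev (take k v) ++ drop k v
  else v.

Definition b_map (w : seq rletter) : seq eletter :=
  rev_before_last_r (map subst_RE w).

Definition b_inv (v : seq eletter) : seq rletter :=
  map subst_ER (rev_before_last_r v).

(* Main.v *)
Require Import Defs.
From mathcomp Require Import all_boot zify.

(** Each operator preserves its class of permutations, so membership of a word
    in either language is a condition on consecutive letters. Read from the
    right, a word of L_Rect is 1^k (k > 0), possibly followed by a [d] and
    letters among which no [2] or [u] comes just after a [1], because [2] and
    [u] require a first entry distinct from 1. A word of L_Evil is s^k (k > 0),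
    possibly followed by an [r] and letters among which no [s] comes just after
    a [p] or [q]: after [r] the permutation ends with 1...t and [s] preserves
    this, while [p] and [q] destroy it until the next [r]. Reversal exchanges
    the two forbidden factors. The delicate operator is [q]: below its smallest
    recoil a permutation is increasing. *)

(** * Inserting a value *)

Definition shift (i x : nat) : nat := if i <= x then x.+1 else x.

(** The four forbidden patterns are bundled into one boolean predicate on quadruples, so that each
    operator leaves one analysis of subsequences and one goal in linear arithmetic. *)
Definition no4 (P : nat -> nat -> nat -> nat -> bool) (pi : seq nat) : Prop :=
  forall a b c d, subseq [:: a; b; c; d] pi -> ~~ P a b c d.

(** The disjuncts are, in order, 2413, 2431, 4213 and 4231. *)
Definition rect_bad (a b c d : nat) : bool :=
  [|| [&& c < a, a < d & d < b], [&& d < a, a < c & c < b],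
      [&& c < b, b < d & d < a] | [&& d < b, b < c & c < a]].

(** The disjuncts are, in order, 2413, 4132, 4213 and 3214. *)
Definition evil_bad (a b c d : nat) : bool :=
  [|| [&& c < a, a < d & d < b], [&& b < d, d < c & c < a],
      [&& c < b, b < d & d < a] | [&& c < b, b < a & a < d]].

(** A disjunction of linear facts, on which [lia] can split by itself. *)
Lemma shiftP i x : i <= x /\ shift i x = x.+1 \/ x < i /\ shift i x = x.
Proof. by rewrite /shift; case: leqP => ?; [left|right]. Qed.

Lemma shift_mono i x y : (shift i x < shift i y) = (x < y).
Proof. have := shiftP i x; have := shiftP i y; lia. Qed.

Lemma shift_inj i : injective (shift i).
Proof. by move=> x y; have := shiftP i x; have := shiftP i y; lia. Qed.

Lemma notin_map_shift i s : i \notin map (shift i) s.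
Proof. by apply/mapP => -[x _]; have := shiftP i x; lia. Qed.

Lemma rhoE i j pi :
  rho i j pi = take j.-1 (map (shift i) pi) ++ i :: drop j.-1 (map (shift i) pi).
Proof. by []. Qed.

Lemma rho_front i pi : rho i 1 pi = i :: map (shift i) pi.
Proof. by rewrite rhoE take0 drop0. Qed.

Lemma rho_back i pi : rho i (size pi).+1 pi = rcons (map (shift i) pi) i.
Proof. by rewrite rhoE /= take_oversize ?drop_oversize ?size_map // cats1. Qed.

Lemma size_rho i j pi : size (rho i j pi) = (size pi).+1.
Proof.
rewrite rhoE size_cat /= addnS -size_cat cat_take_drop size_map //.
Qed.

Lemma is_permP pi :
  is_perm pi <-> uniq pi /\ (forall x, x \in pi -> 0 < x <= size pi).
Proof.
rewrite /is_perm; split=> [pi_iota | [pi_uniq pi_range]].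
  split; first by rewrite (perm_uniq pi_iota) iota_uniq.
  by move=> x; rewrite (perm_mem pi_iota) mem_iota add1n ltnS.
have sub : {subset pi <= iota 1 (size pi)}.
  by move=> x /pi_range; rewrite mem_iota add1n ltnS.
have [|_ eq_mem] := uniq_min_size pi_uniq sub; first by rewrite size_iota.
by apply: uniq_perm; rewrite ?iota_uniq.
Qed.

Lemma mem_is_perm pi x : is_perm pi -> (x \in pi) = (0 < x <= size pi).
Proof. by move=> /perm_mem->; rewrite mem_iota add1n ltnS. Qed.

Lemma shift1_gt1 pi x : is_perm pi -> x \in map (shift 1) pi -> 1 < x.
Proof.
move=> pi_perm /mapP [y]; rewrite (mem_is_perm _ _ pi_perm) => y_gt0 ->.
have := shiftP 1 y; lia.
Qed.

Lemma is_perm_uniq pi : is_perm pi -> uniq pi.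
Proof. by move/is_permP => []. Qed.

Lemma is_perm_rho i j pi :
  0 < i <= (size pi).+1 -> is_perm pi -> is_perm (rho i j pi).
Proof.
move=> i_range /is_permP [pi_uniq pi_range].
have rho_perm : perm_eq (rho i j pi) (i :: map (shift i) pi).
  by apply/permP => p; rewrite rhoE count_cat /= addnCA -count_cat cat_take_drop.
apply/is_permP; rewrite (perm_uniq rho_perm) size_rho /= notin_map_shift.
rewrite (map_inj_uniq (@shift_inj i)) pi_uniq; split=> // x.
rewrite (perm_mem rho_perm) inE => /orP [/eqP->|/mapP [y /pi_range]] //.
by move=> y_range ->; have := shiftP i y; lia.
Qed.

(** * Patterns of length four *)

Lemma subseq_map_ex (f : nat -> nat) s pi :
  subseq s (map f pi) -> exists2 s', subseq s' pi & s = map f s'.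
Proof.
move=> /subseqP [m _ ->]; exists (mask m pi); first exact: mask_subseq.
by rewrite map_mask.
Qed.

Lemma no4_map (P : nat -> nat -> nat -> nat -> bool) f pi :
  (forall a b c d, P (f a) (f b) (f c) (f d) = P a b c d) ->
  no4 P pi -> no4 P (map f pi).
Proof.
move=> Pf pi_no4 a b c d /subseq_map_ex [[|a' [|b' [|c' [|d' []]]]] //= sub].
by case=> -> -> -> ->; rewrite Pf; apply: pi_no4.
Qed.

Lemma rect_bad_shift i pi : no4 rect_bad pi -> no4 rect_bad (map (shift i) pi).
Proof. by apply: no4_map => a b c d; rewrite /rect_bad !shift_mono. Qed.

Lemma evil_bad_shift i pi : no4 evil_bad pi -> no4 evil_bad (map (shift i) pi).
Proof. by apply: no4_map => a b c d; rewrite /evil_bad !shift_mono. Qed.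

Lemma no4_subseq P s pi : subseq s pi -> no4 P pi -> no4 P s.
Proof. by move=> s_pi pi_no4 a b c d /subseq_trans/(_ s_pi)/pi_no4. Qed.

Lemma no4_cons P x pi :
  (forall b c d, subseq [:: b; c; d] pi -> ~~ P x b c d) ->
  no4 P pi -> no4 P (x :: pi).
Proof.
move=> Px pi_no4 a b c d /=; case: eqP => [->|_]; [exact: Px|exact: pi_no4].
Qed.

Lemma subseq_cons_or a s (x : nat) pi :
  subseq (a :: s) (x :: pi) -> a = x /\ subseq s pi \/ subseq (a :: s) pi.
Proof. by move=> /=; case: eqP => [->|_]; [left|right]. Qed.

Lemma subseq_rcons2 s a pi (x : nat) :
  subseq (rcons s a) (rcons pi x) =
  if a == x then subseq s pi else subseq (rcons s a) pi.
Proof.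
rewrite -subseq_rev !rev_rcons /=.
by case: eqP => _; rewrite -?rev_rcons subseq_rev.
Qed.

Lemma no4_rcons P x pi :
  (forall a b c, subseq [:: a; b; c] pi -> ~~ P a b c x) ->
  no4 P pi -> no4 P (rcons pi x).
Proof.
move=> Px pi_no4 a b c d; rewrite (subseq_rcons2 [:: a; b; c] d).
by case: eqP => [->|_]; [exact: Px|exact: pi_no4].
Qed.

Lemma avoidsP pi p q r s : 
  avoids pi [:: p; q; r; s] <->
  no4 (fun a b c d => same_order [:: a; b; c; d] [:: p; q; r; s]) pi.
Proof.
split=> [pi_av a b c d sub | pi_no4 [t [sub ord]]].
  by apply/negP => ord; apply: pi_av; exists [:: a; b; c; d].
have : size t = 4 by case/andP: ord => /eqP.
case: t sub ord => [|a [|b [|c [|d []]]]] // sub ord _.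
by have := pi_no4 _ _ _ _ sub; rewrite ord.
Qed.

Lemma rectangularP pi : rectangular pi <-> is_perm pi /\ no4 rect_bad pi.
Proof.
rewrite /rectangular !avoidsP /no4; split.
  move=> [pi_perm [A [B [C D]]]]; split=> // a b c d sub.
  have:= A _ _ _ _ sub; have:= B _ _ _ _ sub.
  have:= C _ _ _ _ sub; have:= D _ _ _ _ sub.
  rewrite /same_order /rect_bad /=; lia.
move=> [pi_perm A]; split=> //; (repeat split) => a b c d /A;
  rewrite /same_order /rect_bad /=; lia.
Qed.

Lemma evil_avoidingP pi : evil_avoiding pi <-> is_perm pi /\ no4 evil_bad pi.
Proof.
rewrite /evil_avoiding !avoidsP /no4; split.
  move=> [pi_perm [A [B [C D]]]]; split=> // a b c d sub.
  have:= A _ _ _ _ sub; have:= B _ _ _ _ sub.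
  have:= C _ _ _ _ sub; have:= D _ _ _ _ sub.
  rewrite /same_order /evil_bad /=; lia.
move=> [pi_perm A]; split=> //; (repeat split) => a b c d /A;
  rewrite /same_order /evil_bad /=; lia.
Qed.

(** * Rectangular permutations *)

(** No rectangular pattern begins with its smallest letter, so no occurrence uses the new first
    entry 1. *)
Lemma rect_rho1 pi : rectangular pi -> rectangular (rho 1 1 pi).
Proof.
move=> /rectangularP [pi_perm pi_no4]; apply/rectangularP; split.
  exact: is_perm_rho.
rewrite rho_front; apply: no4_cons; last exact: rect_bad_shift.
move=> b c d /mem_subseq sub.
have gt1 x : x \in [:: b; c; d] -> 1 < x by move=> /sub; apply: shift1_gt1.
have := gt1 c; have := gt1 d; have := gt1 b; rewrite !inE !eqxx !orbT /rect_bad.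
lia.
Qed.

(** In each rectangular pattern the letter 1 comes third or fourth, so the new entry 1, in second
    position, belongs to no occurrence. *)
Lemma rect_rho2 pi : rectangular pi -> 0 < size pi -> rectangular (rho 1 2 pi).
Proof.
move=> /rectangularP [pi_perm pi_no4] pi_gt0; apply/rectangularP; split.
  exact: is_perm_rho.
have gt1 x : x \in map (shift 1) pi -> 1 < x by apply: shift1_gt1.
have := rect_bad_shift 1 _ pi_no4; rewrite rhoE.
case: (map (shift 1) pi) gt1 => [|x s] gt1 s_no4.
  by move=> a b c d /=; case: ifP.
rewrite /= take0 drop0 => a b c d /=.
have [-> | _] := eqVneq a x; last first.
  have [-> /mem_subseq sub | _ sub] := eqVneq a 1.
    have := gt1 c; have := gt1 d; rewrite !inE !sub ?inE ?eqxx ?orbT //.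
    rewrite /rect_bad; lia.
  by apply: s_no4; apply: subseq_trans sub (subseq_cons _ _).
have [-> /mem_subseq sub | _ sub] := eqVneq b 1.
  have := gt1 c; have := gt1 d; rewrite !inE !sub ?inE ?eqxx ?orbT //.
  rewrite /rect_bad; lia.
by apply: s_no4; rewrite /= eqxx.
Qed.

(* Adjacent entries with consecutive values are interchangeable in any
   occurrence of a pattern, and the first two letters of the patterns differ by
   2, so no occurrence uses both. *)
Lemma rect_twin x y s :
  (x == y.+1) || (y == x.+1) -> x \notin s -> y \notin s ->
  no4 rect_bad (y :: s) -> no4 rect_bad (x :: y :: s).
Proof.
move=> xy /memPn x_s /memPn y_s ys_no4; apply: no4_cons => // b c d.
case/subseq_cons_or => [[-> /mem_subseq sub] | sub].
  have [c_s d_s] : c \in s /\ d \in s by rewrite !sub ?inE ?eqxx ?orbT.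
  move: (x_s _ c_s) (y_s _ c_s) (x_s _ d_s) (y_s _ d_s); rewrite /rect_bad; lia.
have ybcd : ~~ rect_bad y b c d by apply: ys_no4; rewrite /= eqxx.
have [b_s c_s d_s] : [/\ b \in s, c \in s & d \in s].
  by rewrite !(mem_subseq sub) ?inE ?eqxx ?orbT.
move: (x_s _ b_s) (y_s _ b_s) (x_s _ c_s) (y_s _ c_s) (x_s _ d_s) (y_s _ d_s).
move: ybcd; rewrite /rect_bad; lia.
Qed.

(** The old first entry [h] is shifted to [h.+1], so the new word starts with the twins [h], [h.+1].
    In [rect_rho_d] it is left in place and the twins are [h.+1], [h]. *)
Lemma rect_rho_u h pi :
  rectangular (h :: pi) -> rectangular (rho h 1 (h :: pi)).
Proof.
move=> /rectangularP [pi_perm pi_no4]; apply/rectangularP; split.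
  apply: is_perm_rho (pi_perm); have := mem_is_perm _ h pi_perm.
  rewrite mem_head; lia.
have := rect_bad_shift h _ pi_no4; rewrite rho_front /=.
have /= /andP [h_pi _] := is_perm_uniq _ pi_perm.
have [[_ ->]|[]] := shiftP h h; last by lia.
apply: rect_twin; first by lia.
  exact: notin_map_shift.
apply/mapP => -[y y_pi]; have := shiftP h y.
have : y != h by apply: contraNneq h_pi => <-.
lia.
Qed.

Lemma rect_rho_d h pi :
  rectangular (h :: pi) -> rectangular (rho h.+1 1 (h :: pi)).
Proof.
move=> /rectangularP [pi_perm pi_no4]; apply/rectangularP; split.
  apply: is_perm_rho (pi_perm); have := mem_is_perm _ h pi_perm.
  rewrite mem_head; lia.
have := rect_bad_shift h.+1 _ pi_no4; rewrite rho_front /=.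
have /= /andP [h_pi _] := is_perm_uniq _ pi_perm.
have [[]|[_ ->]] := shiftP h.+1 h; first by lia.
apply: rect_twin; first by lia.
  exact: notin_map_shift.
apply/mapP => -[y y_pi]; have := shiftP h.+1 y.
have : y != h by apply: contraNneq h_pi => <-.
lia.
Qed.

(** * Evil-avoiding permutations *)

(** No evil pattern begins with its smallest letter; for [evil_rho_r], none ends with it. *)
Lemma evil_rho_p pi : evil_avoiding pi -> evil_avoiding (rho 1 1 pi).
Proof.
move=> /evil_avoidingP [pi_perm pi_no4]; apply/evil_avoidingP; split.
  exact: is_perm_rho.
rewrite rho_front; apply: no4_cons; last exact: evil_bad_shift.
move=> b c d /mem_subseq sub.
have gt1 x : x \in [:: b; c; d] -> 1 < x by move=> /sub; apply: shift1_gt1.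
have := gt1 c; have := gt1 d; have := gt1 b; rewrite !inE !eqxx !orbT /evil_bad.
lia.
Qed.

Lemma evil_rho_r pi :
  evil_avoiding pi -> evil_avoiding (rho 1 (size pi).+1 pi).
Proof.
move=> /evil_avoidingP [pi_perm pi_no4]; apply/evil_avoidingP; split.
  exact: is_perm_rho.
rewrite rho_back; apply: no4_rcons; last exact: evil_bad_shift.
move=> b c d /mem_subseq sub.
have gt1 x : x \in [:: b; c; d] -> 1 < x by move=> /sub; apply: shift1_gt1.
have := gt1 c; have := gt1 d; have := gt1 b; rewrite !inE !eqxx !orbT /evil_bad.
lia.
Qed.

(* Likewise, the last two letters of the patterns never form a pair k, k + 1. *)
Lemma evil_twin x s :
  x \notin s -> x.+1 \notin s ->
  no4 evil_bad (rcons s x) -> no4 evil_bad (rcons (rcons s x) x.+1).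
Proof.
move=> /memPn x_s /memPn y_s xs_no4; apply: no4_rcons => // a b c.
rewrite (subseq_rcons2 [:: a; b] c); case: eqP => [-> | _] sub.
  have [a_s b_s] : a \in s /\ b \in s.
    by rewrite !(mem_subseq sub) ?inE ?eqxx ?orbT.
  move: (x_s _ a_s) (y_s _ a_s) (x_s _ b_s) (y_s _ b_s); rewrite /evil_bad; lia.
have abcx : ~~ evil_bad a b c x.
  by apply: xs_no4; rewrite (subseq_rcons2 [:: a; b; c] x) eqxx.
have [a_s b_s c_s] : [/\ a \in s, b \in s & c \in s].
  by rewrite !(mem_subseq sub) ?inE ?eqxx ?orbT.
move: (x_s _ a_s) (y_s _ a_s) (x_s _ b_s) (y_s _ b_s) (x_s _ c_s) (y_s _ c_s).
move: abcx; rewrite /evil_bad; lia.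
Qed.

(** The old last entry [h] is not shifted, so the new word ends with [h], [h.+1] and [evil_twin]
    applies. *)
Lemma evil_rho_s pi h :
  evil_avoiding (rcons pi h) ->
  evil_avoiding (rho h.+1 (size (rcons pi h)).+1 (rcons pi h)).
Proof.
move=> /evil_avoidingP [pi_perm pi_no4]; apply/evil_avoidingP; split.
  apply: is_perm_rho (pi_perm); have := mem_is_perm _ h pi_perm.
  rewrite mem_rcons mem_head; lia.
have := evil_bad_shift h.+1 _ pi_no4; rewrite rho_back map_rcons.
have := is_perm_uniq _ pi_perm; rewrite rcons_uniq => /andP [h_pi _].
have [[]|[_ ->]] := shiftP h.+1 h; first by lia.
apply: evil_twin; last exact: notin_map_shift.
apply/mapP => -[y y_pi]; have := shiftP h.+1 y.
have : y != h by apply: contraNneq h_pi => <-.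
lia.
Qed.

(** * Smallest recoils *)

Lemma sorted_index (pi : seq nat) :
  uniq pi -> sorted (relpre (index^~ pi) ltn) pi.
Proof.
move=> pi_uniq; apply/(sortedP 0) => i i_lt.
by rewrite /= !index_uniq // ltnW.
Qed.

(** Turns questions about subsequences into comparisons of positions. Conversely, [s] and the
    restriction of [pi] to the entries of [s] are both sorted by position and have the same members,
    hence are equal. *)
Lemma subseq_indexP (s pi : seq nat) : uniq pi ->
  subseq s pi <-> {subset s <= pi} /\ sorted (relpre (index^~ pi) ltn) s.
Proof.
move=> pi_uniq; have ltn_tr : transitive (relpre (index^~ pi) ltn).
  by move=> y x z; apply: ltn_trans.
split=> [sub | [s_pi s_sorted]].
  split; first exact: mem_subseq.
  exact: subseq_sorted sub (sorted_index _ pi_uniq).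
apply/(subseq_uniqP pi_uniq); apply: (irr_sorted_eq ltn_tr) => //.
- by move=> x; apply: ltnn.
- exact: sorted_filter (sorted_index _ pi_uniq).
by move=> x; rewrite mem_filter; case: (boolP (x \in s)) => // /s_pi.
Qed.

Lemma recoilP pi i : is_perm pi -> recoil pi i <-> 0 < i /\ subseq [:: i.+1; i] pi.
Proof.
move=> pi_perm; rewrite /recoil (subseq_indexP _ _ (is_perm_uniq _ pi_perm)) /=.
split=> [/andP [i_range ->] | [i_gt0 [sub /andP [-> _]]]].
  split; first by case/andP: i_range.
  split=> // x; rewrite !inE (mem_is_perm _ _ pi_perm); lia.
have := sub i.+1; rewrite !inE eqxx (mem_is_perm _ _ pi_perm); lia.
Qed.

(** Without recoils below [t] the positions of 1...t increase, so both sides are sorted by position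
    in [pi] and have the same members. *)
Lemma no_recoil_filter pi t : is_perm pi -> t <= size pi ->
  (forall i, i < t -> ~~ recoil pi i) ->
  [seq x <- pi | x <= t] = iota 1 t.
Proof.
move=> pi_perm t_le no_recoil; have pi_uniq := is_perm_uniq _ pi_perm.
have ltn_tr : transitive (relpre (index^~ pi) ltn).
  by move=> y x z; apply: ltn_trans.
apply: (irr_sorted_eq ltn_tr) => //.
- by move=> x; apply: ltnn.
- exact: sorted_filter (sorted_index _ pi_uniq).
- apply/(sortedP 0) => i; rewrite size_iota => i_lt.
  have nthE j : j < t -> nth 0 (iota 1 t) j = j.+1 by move=> ?; rewrite nth_iota.
  rewrite /= (nthE i (ltnW i_lt)) (nthE i.+1 i_lt).
  have := no_recoil i.+1 i_lt; rewrite /recoil.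
  (* A non-recoil gives only a weak inequality of positions; equality is excluded because both
     values occur in [pi]. *)
  have [eq_ix|] := eqVneq (index i.+1 pi) (index i.+2 pi); last by lia.
  have i1_pi : i.+1 \in pi by rewrite (mem_is_perm _ _ pi_perm); lia.
  have i2_pi : i.+2 \in pi by rewrite (mem_is_perm _ _ pi_perm); lia.
  have := nth_index 0 i1_pi; rewrite eq_ix nth_index //; lia.
move=> x; rewrite mem_filter mem_iota (mem_is_perm _ _ pi_perm); lia.
Qed.

(** With no recoil at all, [no_recoil_filter] for [t = size pi] makes [pi] the identity. *)
Lemma exists_smallest_recoil pi :
  is_perm pi -> ~ identity_perm pi -> exists t, smallest_recoil pi t.
Proof.
move=> pi_perm pi_nid.
have [has_recoil|/hasPn no_recoil] := boolP (has (recoil pi) (iota 0 (size pi))).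
  have ex : exists t, recoil pi t by case/hasP: has_recoil => t; exists t.
  case: (ex_minnP ex) => t t_rec t_min; exists t; split=> // i i_lt.
  by apply/negP => /t_min; lia.
case: pi_nid; rewrite /identity_perm -(no_recoil_filter _ _ pi_perm (leqnn _)).
  by apply/esym/all_filterP/allP => x; rewrite (mem_is_perm _ _ pi_perm) => /andP[].
by move=> i i_lt; apply: no_recoil; rewrite mem_iota.
Qed.

Lemma smallest_recoil_incr pi t x y : is_perm pi -> smallest_recoil pi t ->
  x <= t -> y <= t -> subseq [:: x; y] pi -> x < y.
Proof.
move=> pi_perm [t_rec t_min] x_t y_t sub.
have t_le : t <= size pi by move: t_rec; rewrite /recoil; lia.
have filt := no_recoil_filter _ _ pi_perm t_le t_min.
have : subseq [:: x; y] (iota 1 t).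
  by rewrite -filt subseq_filter sub /= x_t y_t.
by move/(subseq_sorted ltn_trans)/(_ (iota_ltn_sorted 1 t)) => /= /andP[].
Qed.

Lemma index_lt_subseq4 (pi : seq nat) a b c d : uniq pi ->
  [/\ a \in pi, b \in pi, c \in pi & d \in pi] ->
  index a pi < index b pi -> index b pi < index c pi ->
  index c pi < index d pi -> subseq [:: a; b; c; d] pi.
Proof.
move=> pi_uniq [a_pi b_pi c_pi d_pi] ab bc cd.
apply/(subseq_indexP _ _ pi_uniq); rewrite /= ab bc cd; split=> // x.
by rewrite !inE => /or4P [] /eqP ->.
Qed.

Lemma index_neq (pi : seq nat) x y :
  x \in pi -> y \in pi -> x != y -> index x pi != index y pi.
Proof.
move=> x_pi y_pi; apply: contraNneq => eq_xy.
by rewrite -(nth_index 0 x_pi) eq_xy nth_index.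
Qed.

(* Prefixed by an inserted [t.+1], such a [b; c; d] would be an occurrence of
   2413. In [pi] itself [t.+1] precedes [t]; wherever they lie with respect to
   [b; c; d], the entries together contain one of 2413, 4213 and 4132. *)
Lemma no_312_across_recoil pi t b c d :
  evil_avoiding pi -> smallest_recoil pi t ->
  subseq [:: b; c; d] pi -> c <= t -> t < d -> d < b -> False.
Proof.
move=> /evil_avoidingP [pi_perm pi_no4] [t_rec _] sub c_t t_d d_b.
have pi_uniq := is_perm_uniq _ pi_perm.
have [b_pi c_pi d_pi] : [/\ b \in pi, c \in pi & d \in pi].
  by rewrite !(mem_subseq sub) ?inE ?eqxx ?orbT.
have [_ /= /and3P [bc cd _]] := iffLR (subseq_indexP _ _ pi_uniq) sub.
have [t_gt0 tsub] := iffLR (recoilP _ _ pi_perm) t_rec.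
have [t1_pi t_pi] : t.+1 \in pi /\ t \in pi.
  by rewrite !(mem_subseq tsub) ?inE ?eqxx ?orbT.
have [_ /= /andP [tt _]] := iffLR (subseq_indexP _ _ pi_uniq) tsub.
have no_index4 x y z w : x \in pi -> y \in pi -> z \in pi -> w \in pi ->
    index x pi < index y pi -> index y pi < index z pi ->
    index z pi < index w pi -> ~~ evil_bad x y z w.
  by move=> *; apply: pi_no4; apply: index_lt_subseq4.
have c_t1 : index c pi != index t.+1 pi by apply: index_neq => //; lia.
have ct_cases : c = t \/ c < t by lia.
have dt_cases : d = t.+1 \/ t.+1 < d by lia.
have b_t1 : index b pi != index t.+1 pi by apply: index_neq => //; lia.
(* If [c] precedes [t.+1], then [b], [c], [t.+1], [t] form 4132. Otherwise [d] differs from [t.+1],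
   and either [b], [t.+1], [c], [d] form 4213 or [t.+1], [b], [c], [d] form 2413. *)
have [c_lt|c_gt] := ltnP (index c pi) (index t.+1 pi).
  have c_lt_t : c < t by case: ct_cases => // ct; subst c; lia.
  have := no_index4 b c t.+1 t b_pi c_pi t1_pi t_pi; rewrite /evil_bad; lia.
have t1_lt_d : t.+1 < d by case: dt_cases => // dt; subst d; lia.
have [b_lt|b_gt] := ltnP (index b pi) (index t.+1 pi).
  have := no_index4 b t.+1 c d b_pi t1_pi c_pi d_pi; rewrite /evil_bad; lia.
have := no_index4 t.+1 b c d t1_pi b_pi c_pi d_pi; rewrite /evil_bad; lia.
Qed.

(** After their first letter, 4132, 4213 and 3214 have a descent between adjacent letters below it,
    which is impossible since the entries up to [t] increase. This leaves 2413, excluded by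
    [no_312_across_recoil]. *)
Lemma evil_rho_q pi t : evil_avoiding pi -> smallest_recoil pi t ->
  evil_avoiding (rho t.+1 1 pi).
Proof.
move=> pi_evil t_rec; have /evil_avoidingP [pi_perm pi_no4] := pi_evil.
apply/evil_avoidingP; split.
  apply: is_perm_rho => //; case: t_rec; rewrite /recoil; lia.
rewrite rho_front; apply: no4_cons; last exact: evil_bad_shift.
move=> b c d /subseq_map_ex [[|b' [|c' [|d' []]]] //= sub [-> -> ->]].
have bc : subseq [:: b'; c'] pi.
  exact: subseq_trans (prefix_subseq [:: b'; c'] [:: d']) sub.
have cd : subseq [:: c'; d'] pi.
  exact: subseq_trans (suffix_subseq [:: b'] [:: c'; d']) sub.
have lt_bc : b' <= t -> c' <= t -> b' < c'.
  by move=> b_t c_t; apply: smallest_recoil_incr t_rec b_t c_t bc.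
have lt_cd : c' <= t -> d' <= t -> c' < d'.
  by move=> c_t d_t; apply: smallest_recoil_incr t_rec c_t d_t cd.
have no312 := no_312_across_recoil _ _ _ _ _ pi_evil t_rec sub.
have := shiftP t.+1 b'; have := shiftP t.+1 c'; have := shiftP t.+1 d'.
rewrite /evil_bad; lia.
Qed.

(** * Permutations ending with 1...t *)

(** The part of the domain of [Es] other than the identities. *)
Definition ends_incr (pi : seq nat) : Prop :=
  exists t, 1 <= t /\ t <= size pi /\ drop (size pi - t) pi = iota 1 t.

Definition psi_s (pi : seq nat) : seq nat :=
  if pi is [::] then [:: 1] else rho (last 0 pi).+1 (size pi).+1 pi.

Lemma map_shift_small i s :
  (forall x, x \in map (shift i) s -> x < i) -> map (shift i) s = s.
Proof.
move=> lt_i; rewrite -[RHS]map_id; apply/eq_in_map => x x_s.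
have := lt_i _ (map_f _ x_s); have := shiftP i x; lia.
Qed.

Lemma map_shift_iota i m k :
  m + k <= i -> map (shift i) (iota m k) = iota m k.
Proof.
move=> le_i; apply: map_shift_small => x /mapP [y]; rewrite mem_iota => y_lt ->.
have := shiftP i y; lia.
Qed.

Lemma ends_incrP pi : ends_incr pi <-> exists s k, pi = s ++ iota 1 k.+1.
Proof.
split=> [[[|t] [// _ [_ drop_eq]]] | [s [k ->]]].
  by exists (take (size pi - t.+1) pi), t; rewrite -drop_eq cat_take_drop.
exists k.+1; rewrite size_cat size_iota addnK drop_size_cat ?leq_addl //.
Qed.

Lemma identity_cons x s : identity_perm (x :: s) -> x = 1.
Proof. by case. Qed.

Lemma identity_shift1 pi : is_perm pi -> identity_perm (rho 1 1 pi) -> identity_perm pi.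
Proof.
rewrite /identity_perm rho_front /= size_map => pi_perm [eq_pi].
apply: (inj_map succn_inj).
rewrite -[RHS](iotaDl 1 1) -eq_pi; apply/eq_in_map => x.
rewrite (mem_is_perm _ _ pi_perm) => x_gt0; have := shiftP 1 x; lia.
Qed.

(** Either the final run 1...k+1 is the whole new word, or it lies in the shifted copy of [pi]. In
    the latter case it misses [x], so [x] exceeds the run and the shift has left the run
    unchanged. *)
Lemma ends_rho_front x pi : is_perm pi ->
  ends_incr (rho x 1 pi) -> identity_perm pi \/ ends_incr pi /\ 1 < x.
Proof.
move=> pi_perm /ends_incrP [[|y s] [k]]; rewrite rho_front.
  move=> eq_pi; left; move: (eq_pi) => [x1 _]; rewrite x1 in eq_pi.
  apply: identity_shift1 => //; rewrite /identity_perm rho_front eq_pi.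
  by rewrite /= size_iota.
move=> /(congr1 behead); rewrite -/(map (shift x) pi = s ++ iota 1 k.+1).
move=> eq_pi; right.
have mem_pi z : 0 < z <= k.+1 -> z \in map (shift x) pi.
  by rewrite eq_pi mem_cat mem_iota => z_range; apply/orP; right; lia.
have x_gt : k.+1 < x.
  rewrite ltnNge; apply/negP => x_le.
  (* If [x] is 0, every entry is shifted, and 1 could only come from an entry 0. *)
  have [x0|x_gt0] := posnP x; last first.
    by have := notin_map_shift x pi; rewrite mem_pi // x_gt0.
  have /mapP [z] := mem_pi 1 isT; rewrite (mem_is_perm _ _ pi_perm).
  by have := shiftP x z; lia.
split; last by lia.
apply/ends_incrP; exists (take (size s) pi), k.
rewrite -{1}(cat_take_drop (size s) pi); congr (_ ++ _).
have drop_eq : map (shift x) (drop (size s) pi) = iota 1 k.+1.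
  by rewrite map_drop eq_pi drop_size_cat.
rewrite -drop_eq map_shift_small // drop_eq => z; rewrite mem_iota; lia.
Qed.

Lemma ends_rho_r pi : ends_incr (rho 1 (size pi).+1 pi).
Proof.
by apply/ends_incrP; exists (map (shift 1) pi), 0; rewrite rho_back cats1.
Qed.

Lemma iota_rcons m n : iota m n.+1 = rcons (iota m n) (m + n).
Proof. by rewrite -addn1 iotaD cats1. Qed.

Lemma identity_rho_r pi :
  0 < size pi -> ~ identity_perm (rho 1 (size pi).+1 pi).
Proof.
rewrite /identity_perm size_rho rho_back iota_rcons => pi_gt0 /rcons_inj [_].
lia.
Qed.

Lemma psi_s_rcons s h :
  psi_s (rcons s h) = rcons (map (shift h.+1) (rcons s h)) h.+1.
Proof. by rewrite -rho_back -{2}(last_rcons 0 s h); case: s. Qed.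

Lemma psi_s_ends s k : psi_s (s ++ iota 1 k.+1) =
  map (shift k.+2) s ++ iota 1 k.+2.
Proof.
have small : map (shift k.+2) (iota 1 k.+1) = iota 1 k.+1.
  by rewrite map_shift_iota.
rewrite (iota_rcons 1 k) -rcons_cat psi_s_rcons rcons_cat -(iota_rcons 1 k).
by rewrite map_cat small rcons_cat (iota_rcons 1 k.+1).
Qed.

Lemma psi_s_iota k : psi_s (iota 1 k) = iota 1 k.+1.
Proof. by case: k => // k; apply: (psi_s_ends [::]). Qed.

Lemma identity_psi_s pi : 0 < size pi ->
  identity_perm (psi_s pi) -> identity_perm pi.
Proof.
case/lastP: pi => // s h _; rewrite psi_s_rcons /identity_perm.
rewrite size_rcons size_map iota_rcons => /rcons_inj [eq_pi [h_eq]].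
rewrite -eq_pi map_shift_small // eq_pi => x; rewrite mem_iota; lia.
Qed.

Lemma evil_psi_s pi : evil_avoiding pi -> evil_avoiding (psi_s pi).
Proof.
case/lastP: pi => [_|s h /evil_rho_s]; last first.
  by rewrite rho_back psi_s_rcons.
by apply/evil_avoidingP; split=> // a b c d /=; case: ifP.
Qed.

(** * Sandwiched permutations *)

(** Replaces positions by a factorization: [gamma] carries [x] leftwards across the block [m]. The
    successors convert sizes of prefixes into 1-based positions. *)
Lemma gamma_cat p m x s :
  gamma (size (p ++ m)).+1 (size p).+1 (p ++ m ++ x :: s) = p ++ x :: m ++ s.
Proof.
have take_eq : take (size (p ++ m)) (p ++ m ++ x :: s) = p ++ m.
  by rewrite catA take_size_cat.
have drop_eq : drop (size (p ++ m)).+1 (p ++ m ++ x :: s) = s.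
  by rewrite catA -cat_rcons drop_size_cat ?size_rcons.
have nth_eq : nth 0 (p ++ m ++ x :: s) (size (p ++ m)) = x.
  by rewrite catA nth_cat ltnn subnn.
rewrite /gamma !succnK take_eq drop_eq nth_eq -catA.
by rewrite (take_size_cat _ (erefl (size p))) (drop_size_cat _ (erefl (size p))).
Qed.

(** The definition lets the prefix and the suffix overlap or touch. An overlap would put the value
    [a.+1] inside the prefix 1...a, and touching would make [pi] the identity; so a nonempty middle
    remains, whose entries avoid 1...a+b. *)
Lemma sandwichedP pi a b : is_perm pi -> ~ identity_perm pi ->
  sandwiched pi a b ->
  exists2 s, pi = iota 1 a ++ s ++ iota a.+1 b &
    [/\ 0 < b, 0 < size s & forall x, x \in s -> a + b < x].
Proof.
move=> pi_perm pi_nid [b_gt0 [take_eq drop_eq]].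
have a_le : a <= size pi.
  have := congr1 size take_eq; rewrite size_take_min size_iota; lia.
have b_le : b <= size pi.
  have := congr1 size drop_eq; rewrite size_drop size_iota; lia.
have nth_b : nth 0 pi (size pi - b) = a.+1.
  by rewrite -[size pi - b]addn0 -nth_drop drop_eq nth_iota // addn0.
have ab_lt : a + b < size pi.
  have [//|ab_ge] := ltnP; have [ab_eq|ab_gt] : a + b = size pi \/ size pi < a + b by lia.
    case: pi_nid; rewrite /identity_perm -{1}(cat_take_drop a pi) take_eq.
    by rewrite -ab_eq iotaD -drop_eq; congr (_ ++ drop _ _); lia.
  have : nth 0 (take a pi) (size pi - b) = a.+1 by rewrite nth_take //; lia.
  rewrite take_eq nth_iota; lia.
pose s := take (size pi - b - a) (drop a pi).
have pi_eq : pi = iota 1 a ++ s ++ iota a.+1 b.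
  rewrite -{1}(cat_take_drop a pi) take_eq; congr (_ ++ _).
  rewrite -{1}(cat_take_drop (size pi - b - a) (drop a pi)); congr (_ ++ _).
  by rewrite drop_drop -drop_eq; congr (drop _ _); lia.
exists s => //; split=> // [|x x_s].
  rewrite size_take_min size_drop; lia.
have := is_perm_uniq _ pi_perm; rewrite {1}pi_eq catA cat_uniq cat_uniq.
case/and3P=> /and3P [_ /hasPn /(_ _ x_s) /= x1 _] /hasPn x2 _.
have : x \in pi by rewrite pi_eq !mem_cat x_s orbT.
rewrite (mem_is_perm _ _ pi_perm); move: x1; rewrite mem_iota.
have := x2 x; rewrite /= mem_cat x_s orbT mem_iota; lia.
Qed.

Lemma filter_le_iota t m k : m + k <= t.+1 ->
  [seq x <- iota m k | x <= t] = iota m k.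
Proof. by move=> le_t; apply/all_filterP/allP => x; rewrite mem_iota; lia. Qed.

(** The values up to [a + b] occur in increasing order, so there is no smaller recoil; and
    [(a + b).+1], lying in [s], precedes [a + b], which lies in the final block. *)
Lemma sandwiched_recoil pi a b s t : is_perm pi ->
  pi = iota 1 a ++ s ++ iota a.+1 b -> 0 < b -> 0 < size s ->
  (forall x, x \in s -> a + b < x) -> smallest_recoil pi t -> t = a + b.
Proof.
move=> pi_perm pi_eq b_gt0 s_gt0 s_gt [/(recoilP _ _ pi_perm) [t_gt0 t_rec] t_min].
have filt : [seq x <- pi | x <= a + b] = iota 1 (a + b).
  rewrite pi_eq !filter_cat !filter_le_iota ?iotaD ?addSn ?add1n //; last by lia.
  congr (_ ++ _); rewrite -[RHS]cat0s; congr (_ ++ _).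
  apply/eqP; rewrite -size_eq0 size_filter -leqn0 leqNgt -has_count.
  by apply/hasPn => x /s_gt; rewrite ltnNge.
have [t_lt|t_gt|//] := ltngtP t (a + b).
  have : subseq [:: t.+1; t] (iota 1 (a + b)).
    by rewrite -filt subseq_filter t_rec /= t_lt ltnW.
  move/(subseq_sorted ltn_trans)/(_ (iota_ltn_sorted _ _)) => /=; lia.
have /negP [] := t_min _ t_gt; apply/(recoilP _ _ pi_perm); split; first by lia.
have top_s : (a + b).+1 \in s.
  have : (a + b).+1 \in pi.
    rewrite (mem_is_perm _ _ pi_perm) pi_eq !size_cat !size_iota; lia.
  rewrite pi_eq !mem_cat !mem_iota => /or3P [] //; lia.
rewrite pi_eq; apply: subseq_trans (suffix_subseq _ _).
apply: (cat_subseq (s1 := [:: (a + b).+1])); rewrite sub1seq // mem_iota; lia.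
Qed.

(** After the insertion, position n-b+2 holds [a.+1], the first entry of the final block, and
    [gamma] moves it right after 1...a. *)
Lemma gamma_rho_sandwiched a b s : 0 < b -> (forall x, x \in s -> a + b < x) ->
  let pi := iota 1 a ++ s ++ iota a.+1 b in
  gamma (size pi - b + 2) (a + 2) (rho (a + b).+1 1 pi) =
  (a + b).+1 :: iota 1 a.+1 ++ map succn s ++ iota a.+2 b.-1.
Proof.
case: b => // b _ s_gt pi.
have -> : rho (a + b.+1).+1 1 pi =
    ((a + b.+1).+1 :: iota 1 a) ++ map succn s ++ a.+1 :: iota a.+2 b.
  rewrite rho_front !map_cat !map_shift_iota /=; try lia.
  congr (_ :: _ ++ _ ++ _); apply/eq_in_map => x /s_gt.
  have := shiftP (a + b.+1).+1 x; lia.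
have := gamma_cat ((a + b.+1).+1 :: iota 1 a) (map succn s) a.+1 (iota a.+2 b).
have -> : size pi - b.+1 + 2 =
    (size (((a + b.+1).+1 :: iota 1 a) ++ map succn s)).+1.
  rewrite /pi !size_cat /= !size_map !size_iota; lia.
have -> : a + 2 = (size ((a + b.+1).+1 :: iota 1 a)).+1.
  rewrite /= size_iota; lia.
by move=> ->; rewrite iota_rcons cat_rcons.
Qed.

Lemma perm_is_perm s1 s2 : perm_eq s1 s2 -> is_perm s2 -> is_perm s1.
Proof.
rewrite /is_perm => eq12; rewrite (perm_size eq12); exact: perm_trans.
Qed.

(** The prefix is added one entry at a time, each smaller than all that follows, and no evil pattern
    begins with its smallest letter. *)
Lemma evil_iota_cat m k s :
  (forall x, x \in s -> m + k <= x) -> no4 evil_bad s ->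
  no4 evil_bad (iota m k ++ s).
Proof.
elim: k m => [//|k IH] m s_ge s_no4 /=.
apply: no4_cons; last by apply: IH => // x /s_ge; lia.
have gt_m x : x \in iota m.+1 k ++ s -> m < x.
  by rewrite mem_cat mem_iota => /orP [|/s_ge]; lia.
move=> b c d /mem_subseq sub.
have [b_gt c_gt d_gt] : [/\ m < b, m < c & m < d].
  by split; apply: gt_m; rewrite sub ?inE ?eqxx ?orbT.
rewrite /evil_bad; lia.
Qed.

(* The entries below [t.+1] increase, and those above are contiguous: hence no
   forbidden pattern starts with [t.+1]. *)
Lemma evil_block a b (s : seq nat) :
  (forall x, x \in s -> a + b.+1 < x) ->
  uniq s ->
  no4 evil_bad (s ++ iota a.+2 b) ->
  no4 evil_bad ((a + b.+1).+1 :: iota 1 a.+1 ++ s ++ iota a.+2 b).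
Proof.
move=> s_gt s_uniq s_no4; set w := iota 1 a.+1 ++ _.
have mem_w x : (x \in w) = [|| 0 < x <= a.+1, x \in s | a.+1 < x <= a + b.+1].
  by rewrite !mem_cat !mem_iota; congr [|| _, _ | _]; lia.
have w_uniq : uniq w.
  rewrite cat_uniq iota_uniq cat_uniq s_uniq iota_uniq !andbT !andTb.
  apply/andP; split; apply/hasPn => x x_mem; apply/negP.
    move=> x_low; have : x \in iota 1 a.+1 := x_low.
    move: x_mem; rewrite mem_cat !mem_iota => /orP [/s_gt|]; lia.
  by move/s_gt; move: x_mem; rewrite mem_iota; lia.
(* Positions of the entries in the three zones of [w]: exact in the two increasing blocks, and
   confined to an interval in [s]. *)
have indexE x : x \in w -> [\/ x <= a.+1 /\ index x w = x.-1,
    a + b.+1 < x /\ a.+1 <= index x w < a.+1 + size s |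
    a.+1 < x <= a + b.+1 /\ index x w = size s + x.-1].
  have index_i m k y : m <= y < m + k -> index y (iota m k) = y - m.
    move=> y_range; rewrite -[in LHS](subnKC (proj1 (andP y_range))).
    rewrite -{1}(@nth_iota 0 m k); last by lia.
    by rewrite index_uniq ?iota_uniq ?size_iota; lia.
  rewrite mem_w /w; case/or3P => [x_range|x_s|x_range].
  - by constructor 1; rewrite index_cat mem_iota x_range index_i; lia.
  - constructor 2; have x_gt := s_gt _ x_s; rewrite index_cat mem_iota size_iota.
    rewrite ifF ?index_cat ?x_s; last by lia.
    by split=> //; rewrite leq_addr ltn_add2l index_mem.
  constructor 3; split=> //; rewrite index_cat mem_iota size_iota ifF; last by lia.
  rewrite index_cat ifF; last by apply/negP => /s_gt; lia.
  rewrite index_i 1?addnCA; [congr (_ + _)|]; lia.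
apply: no4_cons => [x y z sub|].
  have [sub_w /= /and3P [xy yz _]] := iffLR (subseq_indexP _ _ w_uniq) sub.
  have [x_w y_w z_w] : [/\ x \in w, y \in w & z \in w].
    by rewrite !sub_w ?inE ?eqxx ?orbT.
  have := indexE _ x_w; have := indexE _ y_w; have := indexE _ z_w.
  move: xy yz; rewrite /evil_bad /=.
  move: (index x w) (index y w) (index z w) (size s) => ix iy iz n xy yz Hz Hy Hx.
  by case: Hx => Hx; case: Hy => Hy; case: Hz => Hz; lia.
apply: evil_iota_cat => // x; rewrite mem_cat mem_iota => /orP [/s_gt|]; lia.
Qed.

Lemma gamma_rho_q_spec pi t a b :
  evil_avoiding pi -> ~ identity_perm pi -> smallest_recoil pi t ->
  sandwiched pi a b ->
  let pi' := gamma (size pi - b + 2) (a + 2) (rho t.+1 1 pi) in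
  [/\ evil_avoiding pi', ~ identity_perm pi' & ~ ends_incr pi'].
Proof.
move=> pi_evil pi_nid t_rec pi_sand pi'.
have /evil_avoidingP [pi_perm pi_no4] := pi_evil.
have [s pi_eq [b_gt0 s_gt0 s_gt]] := sandwichedP _ _ _ pi_perm pi_nid pi_sand.
have t_eq := sandwiched_recoil _ _ _ _ _ pi_perm pi_eq b_gt0 s_gt0 s_gt t_rec.
case: b b_gt0 pi_sand pi_eq s_gt t_eq @pi' => // b _ pi_sand pi_eq s_gt t_eq.
have -> : gamma (size pi - b.+1 + 2) (a + 2) (rho t.+1 1 pi) =
    (a + b.+1).+1 :: iota 1 a.+1 ++ map succn s ++ iota a.+2 b.
  by rewrite t_eq [in LHS]pi_eq; apply: gamma_rho_sandwiched.
set pi' := _ :: _.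
have s_shift : map succn s = map (shift t.+1) s.
  apply/eq_in_map => x /s_gt; have := shiftP t.+1 x; lia.
have rho_eq : perm_eq pi' (rho t.+1 1 pi).
  rewrite rho_front pi_eq !map_cat -s_shift !map_shift_iota; try lia.
  rewrite /pi' t_eq perm_cons iota_rcons cat_rcons perm_cat2l.
  by rewrite -cat1s perm_catCA.
have pi'_perm : is_perm pi'.
  apply: perm_is_perm rho_eq _.
  by have /evil_avoidingP [] := evil_rho_q _ _ pi_evil t_rec.
have pi'_uniq := is_perm_uniq _ pi'_perm.
split; last 1 first.
(* The entry 1 stands in second position, so a final run 1...k+1 would have to start there. It would
   then contain all smaller values up to its length, including a second copy of the first entry. *)
- case/ends_incrP => -[|x1 [|x2 u]] [k].
  + by case; lia.
  + rewrite /pi' => -[_ eq_pi].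
    have k_eq : k.+1 = a + size s + b.+1.
      have := congr1 size eq_pi; rewrite /= !size_cat !size_iota size_map; lia.
    move: pi'_uniq; rewrite /pi' /= -/(iota 2 a) => /andP [/negP []].
    have -> : 1 :: iota 2 a ++ map succn s ++ iota a.+2 b = iota 1 k.+1.
      by rewrite eq_pi.
    rewrite mem_iota; lia.
  move=> [_ x2_eq eq_pi]; move: pi'_uniq; rewrite /pi' /= => /and3P [_ /negP one_notin _].
  by apply: one_notin; rewrite eq_pi mem_cat mem_head orbT.
- apply/evil_avoidingP; split=> //; apply: evil_block.
  + by move=> x /mapP [y /s_gt y_gt ->]; lia.
  + rewrite (map_inj_uniq succn_inj).
    by have := is_perm_uniq _ pi_perm; rewrite pi_eq !cat_uniq => /and3P [_ _ /and3P []].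
  (* What follows the block 1...a+1 is a subsequence of the shifted [pi], so it inherits
     avoidance. *)
  have := evil_bad_shift t.+1 _ pi_no4; apply: no4_subseq.
  rewrite pi_eq !map_cat -s_shift; apply: subseq_trans (suffix_subseq _ _).
  rewrite subseq_cat2l /=; apply: subseq_trans (subseq_cons _ _).
  rewrite map_shift_iota //; lia.
by move/identity_cons; lia.
Qed.

Lemma rho_q_spec pi t :
  evil_avoiding pi -> ~ identity_perm pi -> smallest_recoil pi t ->
  (forall a b, ~ sandwiched pi a b) ->
  [/\ evil_avoiding (rho t.+1 1 pi), ~ identity_perm (rho t.+1 1 pi) &
      ~ ends_incr (rho t.+1 1 pi)].
Proof.
move=> pi_evil pi_nid t_rec pi_nsand; split; first exact: evil_rho_q.
  rewrite rho_front => /identity_cons; case: t_rec; rewrite /recoil; lia.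
have /evil_avoidingP [pi_perm _] := pi_evil.
case/(ends_rho_front _ _ pi_perm) => // -[[k [k_gt0 [_ drop_eq]]] _].
(* Ending with 1...k means being (0, k)-sandwiched. *)
by apply: (pi_nsand 0 k); rewrite /sandwiched take0.
Qed.

Lemma stepE_p_spec pi pi' : stepE Ep pi pi' ->
  [/\ evil_avoiding pi', ~ identity_perm pi' & ~ ends_incr pi'].
Proof.
move=> [pi_evil [pi_nid ->]]; have /evil_avoidingP [pi_perm _] := pi_evil.
split; first exact: evil_rho_p.
  by move/(identity_shift1 _ pi_perm).
by case/(ends_rho_front _ _ pi_perm) => // -[].
Qed.

Lemma stepE_q_spec pi pi' : stepE Eq pi pi' ->
  [/\ evil_avoiding pi', ~ identity_perm pi' & ~ ends_incr pi'].
Proof.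
move=> [pi_evil [pi_nid [t [t_rec [[a [b [pi_sand ->]]]|[pi_nsand ->]]]]]].
  exact: gamma_rho_q_spec.
exact: rho_q_spec.
Qed.

(** Being sandwiched for some [a], [b] is decided by a finite search, since comparing sizes bounds
    both by [size pi]. *)
Lemma stepE_q_total pi : evil_avoiding pi -> ~ identity_perm pi ->
  exists pi', stepE Eq pi pi'.
Proof.
move=> pi_evil pi_nid; have /evil_avoidingP [pi_perm _] := pi_evil.
have [t t_rec] := exists_smallest_recoil _ pi_perm pi_nid.
pose sand a b := [&& 0 < b, take a pi == iota 1 a & drop (size pi - b) pi == iota a.+1 b].
have sandP a b : reflect (sandwiched pi a b) (sand a b).
  apply: (iffP and3P) => [[? /eqP ? /eqP]|[? [/eqP ? /eqP]]] //.
have [|no_sand] := boolP (has (fun a => has (sand a) (iota 0 (size pi).+1))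
                              (iota 0 (size pi).+1)).
  case/hasP => a _ /hasP [b _ /sandP ab_sand].
  exists (gamma (size pi - b + 2) (a + 2) (rho t.+1 1 pi)).
  by split=> //; split=> //; exists t; split=> //; left; exists a, b.
exists (rho t.+1 1 pi); split=> //; split=> //; exists t; split=> //; right.
split=> // a b /[dup] [[_ [take_eq drop_eq]]] /sandP ab_sand.
move/hasPn/(_ a): no_sand; rewrite mem_iota => /(_ _)/hasPn/(_ b).
have := congr1 size take_eq; have := congr1 size drop_eq.
rewrite size_take_min size_drop !size_iota mem_iota ab_sand => b_le a_le no.
by have : false by apply: no; lia.
Qed.

(** * The languages *)

Definition is_pq (x : eletter) : bool := match x with Ep | Eq => true | _ => false end.

Definition is_s (x : eletter) : bool := if x is Es then true else false.

(** Words list the last applied letter first, so [x] is applied right after [y]. In [allowedR] the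
    arguments are swapped because [b_map] reverses the part concerned. *)
Definition allowedE : rel eletter := fun x y => ~~ (is_s x && is_pq y).

Definition allowedR : rel rletter := fun x y => allowedE (subst_RE y) (subst_RE x).

(** The displayed [Er] is the first one applied; [u] may contain others. *)
Definition formE (v : seq eletter) : Prop :=
  (exists k, v = nseq k Es) \/
  (exists u k, v = u ++ Er :: nseq k.+1 Es /\ sorted allowedE u).

Definition formR (w : seq rletter) : Prop :=
  (exists k, w = nseq k R1) \/
  (exists u k, w = u ++ Rd :: nseq k.+1 R1 /\ sorted allowedR u).

Lemma sorted_cons (T : Type) (r : rel T) x s :
  sorted r (x :: s) = (if s is y :: _ then r x y else true) && sorted r s.
Proof. by case: s. Qed.

(** The invariant: identities until the first [Er], non-identities from then on, and no final run
    1...t just after [Ep] or [Eq], which blocks [Es] there. *)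
Lemma reachE_state v pi : reachE v pi ->
  (exists k, v = nseq k Es /\ pi = iota 1 k) \/
  (exists u k, [/\ v = u ++ Er :: nseq k.+1 Es, sorted allowedE u,
    ~ identity_perm pi & (if u is x :: _ then is_pq x else false) -> ~ ends_incr pi]).
Proof.
elim=> {v pi} [|x w pi pi' _ IH step]; first by left; exists 0.
have id_iota k : identity_perm (iota 1 k) by rewrite /identity_perm size_iota.
case: IH => [[k [-> pi_eq]]|[u [k [-> u_sorted pi_nid pi_nends]]]].
  case: x step => /=.
  - by move=> [_ []]; rewrite pi_eq.
  - by move=> [_ []]; rewrite pi_eq.
  (* The predecessor is harmless: [Er] requires a nonempty [pi], so [k] is positive. *)
  - move=> [_ [pi_gt0 ->]]; right; exists [::], k.-1; split=> //.
      by move: pi_gt0; rewrite pi_eq size_iota; case: (k).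
    exact: identity_rho_r.
  move=> [_ [_ ->]]; left; exists k.+1; split=> //.
  by rewrite -/(psi_s pi) pi_eq psi_s_iota.
right; exists (x :: u), k; split=> //; case: x step => step.
- by rewrite sorted_cons u_sorted; case: (u).
- by rewrite sorted_cons u_sorted; case: (u).
- by rewrite sorted_cons u_sorted; case: (u).
- rewrite sorted_cons u_sorted andbT /allowedE.
  case: u pi_nends {u_sorted} => // y u /= pi_nends; apply/negP => /pi_nends.
  by case: step => _ [[|]].
- by have [] := stepE_p_spec _ _ step.
- by have [] := stepE_q_spec _ _ step.
- by case: step => _ [pi_gt0 ->]; apply: identity_rho_r.
- case: step => _ [_ ->]; rewrite -/(psi_s pi) => /identity_psi_s id_pi.
  by apply/pi_nid/id_pi; case: (pi) pi_nid => // -[].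
- by have [] := stepE_p_spec _ _ step.
- by have [] := stepE_q_spec _ _ step.
- by [].
- by [].
Qed.

Lemma evil_reachable_iota k : reachE (nseq k Es) (iota 1 k) /\ evil_avoiding (iota 1 k).
Proof.
elim: k => [|k [reach_k evil_k]].
  split; first exact: reachE0.
  by apply/evil_avoidingP; split=> // a b c d.
split; last by rewrite -psi_s_iota; apply: evil_psi_s.
apply: (reachES (x := Es) reach_k); split=> //; split; last first.
  by rewrite -/(psi_s _) psi_s_iota.
by left; rewrite /identity_perm size_iota.
Qed.

Lemma ends_psi_s pi : ends_incr pi -> ends_incr (psi_s pi).
Proof.
case/ends_incrP => s [k ->]; rewrite psi_s_ends; apply/ends_incrP.
by exists (map (shift k.+2) s), k.+1.
Qed.

(** The converse invariant: a final run 1...t is present unless the last applied letter is [Ep] or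
    [Eq], so every allowed [Es] can be applied. *)
Lemma reachE_r_s u k : sorted allowedE u ->
  exists pi, [/\ reachE (u ++ Er :: nseq k.+1 Es) pi, evil_avoiding pi,
    ~ identity_perm pi &
    ~~ (if u is x :: _ then is_pq x else false) -> ends_incr pi].
Proof.
elim: u => [_|x u IH].
  have [reach_k evil_k] := evil_reachable_iota k.+1.
  exists (rho 1 (size (iota 1 k.+1)).+1 (iota 1 k.+1)); split.
  - by apply: reachES reach_k _.
  - exact: evil_rho_r.
  - exact: identity_rho_r.
  by move=> _; apply: ends_rho_r.
rewrite sorted_cons => /andP [xu /IH [pi [reach_pi evil_pi pi_nid pi_ends]]].
have pi_gt0 : 0 < size pi by case: (pi) pi_nid => // -[].
case: x xu => xu.
- have step : stepE Ep pi (rho 1 1 pi) by [].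
  exists (rho 1 1 pi); have [? ? _] := stepE_p_spec _ _ step; split=> //.
  exact: reachES reach_pi step.
- have [pi' step] := stepE_q_total _ evil_pi pi_nid.
  exists pi'; have [? ? _] := stepE_q_spec _ _ step; split=> //.
  exact: reachES reach_pi step.
- exists (rho 1 (size pi).+1 pi); split.
  + by apply: reachES reach_pi _.
  + exact: evil_rho_r.
  + exact: identity_rho_r.
  by move=> _; apply: ends_rho_r.
have {}pi_ends : ends_incr pi by apply: pi_ends; case: (u) xu.
exists (psi_s pi); split=> [|||_].
- by apply: reachES reach_pi _; split=> //; split=> //; right.
- exact: evil_psi_s.
- by move/(identity_psi_s _ pi_gt0).
exact: ends_psi_s.
Qed.

Lemma L_EvilP v : L_Evil v <-> v <> [::] /\ formE v.
Proof.
split=> [[v_nil [pi /reachE_state v_state]] | [v_nil v_form]]; split=> //.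
  case: v_state => [[k [? _]]|[u [k [? ? _ _]]]]; [left|right]; first by exists k.
  by exists u, k.
case: v_form => [[k ->]|[u [k [-> u_sorted]]]].
  by exists (iota 1 k); have [] := evil_reachable_iota k.
by have [pi []] := reachE_r_s _ k u_sorted; exists pi.
Qed.

(** A first entry 1 just after [R1] blocks [R2] and [Ru]. The clause on the empty word ensures that
    [k] is positive when a word of [R1] yields a nonempty [pi]. *)
Lemma reachR_state w pi : reachR w pi ->
  [/\ formR w, w = [::] -> pi = [::] &
    (if w is R1 :: _ then true else false) -> head 0 pi = 1].
Proof.
elim=> {w pi} [|x w pi pi' _ [w_form w_nil w_head] step].
  by split=> //; left; exists 0.
split=> //; last by case: x step => //= -[_ ->]; rewrite rho_front.
case: w_form => [[k w_eq]|[u [k [w_eq u_sorted]]]].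
  have head1 : 0 < size pi -> head 0 pi = 1.
    move=> pi_gt0; apply: w_head; rewrite w_eq.
    by case: (k) w_eq => // w_eq; rewrite w_nil in pi_gt0.
  case: x step.
  - by left; exists k.+1; rewrite w_eq.
  - by move=> [_ [/head1 -> []]].
  - by move=> [_ [/head1 -> []]].
  move=> [_ [pi_gt0 _]]; right; exists [::], k.-1; rewrite w_eq; split=> //.
  by case: (k) w_eq => // w_eq; rewrite w_nil in pi_gt0.
right; exists (x :: u), k; rewrite w_eq sorted_cons u_sorted andbT; split=> //.
case: u w_eq {u_sorted} => // y u w_eq; rewrite w_eq in w_head.
rewrite /allowedR; case: y w_head {w_eq} => //= /(_ isT) head1.
by case: x step => //= -[_ [_ []]].
Qed.

Lemma reachR_iota k : exists pi, [/\ reachR (nseq k R1) pi, rectangular pi & size pi = k].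
Proof.
elim: k => [|k [pi [reach_pi pi_rect pi_size]]].
  by exists [::]; split; [exact: reachR0|apply/rectangularP; split|].
exists (rho 1 1 pi); split; [|exact: rect_rho1|by rewrite size_rho pi_size].
by apply: reachRS reach_pi _.
Qed.

(** The converse invariant: the first entry differs from 1 unless the last applied letter is [R1].
    It becomes its successor under [Rd], is shifted above 1 under [R2], and is repeated as the new
    first entry under [Ru]. *)
Lemma reachR_d_1 u k : sorted allowedR u ->
  exists pi, [/\ reachR (u ++ Rd :: nseq k.+1 R1) pi, rectangular pi, 0 < size pi &
    (if u is R1 :: _ then false else true) -> head 0 pi <> 1].
Proof.
have step_d pi w : reachR w pi -> rectangular pi -> 0 < size pi ->
  exists pi', [/\ reachR (Rd :: w) pi', rectangular pi', 0 < size pi' & head 0 pi' <> 1].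
  move=> reach_w pi_rect pi_gt0; exists (rho (head 0 pi).+1 1 pi).
  split; last 2 [by rewrite size_rho].
  - by apply: reachRS reach_w _.
  - by case: (pi) pi_rect pi_gt0 => // h s pi_rect _; apply: rect_rho_d.
  rewrite rho_front /= => -[head0]; have /rectangularP [pi_perm _] := pi_rect.
  case: (pi) pi_gt0 pi_perm head0 => //= h s _ pi_perm h0.
  have := mem_is_perm _ 0 pi_perm; by rewrite h0 mem_head.
elim: u => [_|x u IH].
  have [pi [reach_k pi_rect pi_size]] := reachR_iota k.+1.
  have [|pi' [? ? ? ?]] := step_d _ _ reach_k pi_rect; first by rewrite pi_size.
  by exists pi'.
rewrite sorted_cons => /andP [xu /IH [pi [reach_pi pi_rect pi_gt0 pi_head]]].
case: x xu => xu.
- exists (rho 1 1 pi); split=> //; last by rewrite size_rho.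
    by apply: reachRS reach_pi _.
  exact: rect_rho1.
- have {}pi_head : head 0 pi <> 1 by apply: pi_head; case: (u) xu => // -[].
  exists (rho 1 2 pi); split; last 2 [by rewrite size_rho].
  + by apply: reachRS reach_pi _.
  + exact: rect_rho2.
  have /rectangularP [pi_perm _] := pi_rect; move=> _.
  case: (pi) pi_gt0 pi_perm => // h s _ pi_perm; rewrite rhoE /=.
  have := shift1_gt1 _ (shift 1 h) pi_perm; rewrite mem_head => /(_ isT).
  by move=> + h1; rewrite h1.
- have {}pi_head : head 0 pi <> 1 by apply: pi_head; case: (u) xu => // -[].
  exists (rho (head 0 pi) 1 pi); split; last 2 [by rewrite size_rho].
  + by apply: reachRS reach_pi _.
  + by case: (pi) pi_rect pi_gt0 => // h s pi_rect _; apply: rect_rho_u.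
  by rewrite rho_front.
by have [pi' [? ? ? ?]] := step_d _ _ reach_pi pi_rect pi_gt0; exists pi'.
Qed.

Lemma L_RectP w : L_Rect w <-> w <> [::] /\ formR w.
Proof.
split=> [[w_nil [pi /reachR_state [w_form _ _]]] | [w_nil w_form]]; split=> //.
case: w_form => [[k ->]|[u [k [-> u_sorted]]]].
  by have [pi []] := reachR_iota k; exists pi.
by have [pi []] := reachR_d_1 _ k u_sorted; exists pi.
Qed.

(** * The bijection *)

Lemma rev_before_last_r_cat u s : ~~ has is_r s ->
  rev_before_last_r (u ++ Er :: s) = rev u ++ Er :: s.
Proof.
move=> s_r; rewrite /rev_before_last_r has_cat /= orbT.
(* Read from the right, the search passes over [s] and stops at the displayed [Er], so the prefix
   cut off is exactly [u]. *)
rewrite rev_cat rev_cons cat_rcons find_cat has_rev (negbTE s_r) /= addn0.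
rewrite size_rev size_cat /= addnK.
by rewrite (take_size_cat _ (erefl (size u))) (drop_size_cat _ (erefl (size u))).
Qed.

Lemma rev_before_last_r_id v : ~~ has is_r v -> rev_before_last_r v = v.
Proof. by rewrite /rev_before_last_r => /negbTE ->. Qed.

Lemma last_r_split v : has is_r v ->
  exists u s, v = u ++ Er :: s /\ ~~ has is_r s.
Proof.
elim: v => //= x v IH; have [/IH [u [s [-> s_r]]] _|v_r] := boolP (has is_r v).
  by exists (x :: u), s.
by rewrite orbF; case: x => // _; exists [::], v.
Qed.

(** Reversing the prefix leaves the rightmost [Er] in place, so the second application reverses the
    same prefix back. *)
Lemma rev_before_last_rK : involutive rev_before_last_r.
Proof.
move=> v; have [/last_r_split [u [s [-> s_r]]]|v_r] := boolP (has is_r v).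
  by rewrite !rev_before_last_r_cat // revK.
by rewrite !rev_before_last_r_id.
Qed.

Lemma size_rev_before_last_r v : size (rev_before_last_r v) = size v.
Proof.
have [/last_r_split [u [s [-> s_r]]]|v_r] := boolP (has is_r v).
  by rewrite rev_before_last_r_cat // !size_cat size_rev.
by rewrite rev_before_last_r_id.
Qed.

Lemma has_r_nseq k : ~~ has is_r (nseq k Es).
Proof. by rewrite has_nseq andbF. Qed.

Lemma subst_REK : cancel subst_RE subst_ER. Proof. by case. Qed.

Lemma subst_ERK : cancel subst_ER subst_RE. Proof. by case. Qed.

Lemma b_mapK : cancel b_map b_inv.
Proof. by move=> w; rewrite /b_inv /b_map rev_before_last_rK (mapK subst_REK). Qed.

Lemma b_invK : cancel b_inv b_map.
Proof. by move=> v; rewrite /b_map /b_inv (mapK subst_ERK) rev_before_last_rK. Qed.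

Lemma formE_b_map w : formR w -> formE (b_map w).
Proof.
rewrite /b_map; case=> [[k ->]|[u [k [-> u_sorted]]]]; [left|right].
  by exists k; rewrite map_nseq rev_before_last_r_id ?has_r_nseq.
exists (rev (map subst_RE u)), k; split.
  by rewrite map_cat map_cons map_nseq rev_before_last_r_cat ?has_r_nseq.
by rewrite rev_sorted sorted_map.
Qed.

Lemma formR_b_inv v : formE v -> formR (b_inv v).
Proof.
rewrite /b_inv; case=> [[k ->]|[u [k [-> u_sorted]]]]; [left|right].
  by exists k; rewrite rev_before_last_r_id ?has_r_nseq // map_nseq.
exists (map subst_ER (rev u)), k; split.
  by rewrite rev_before_last_r_cat ?has_r_nseq // map_cat map_cons map_nseq.
(* Reversal flips the relation, and the flipped [allowedE] is [allowedR] read through [subst_ER]. *)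
rewrite -[u]revK rev_sorted in u_sorted; rewrite sorted_map.
by rewrite (eq_sorted (e' := fun x y => allowedE y x)) // => x y /=;
  rewrite /allowedR !subst_ERK.
Qed.

Lemma size_b_map w : size (b_map w) = size w.
Proof. by rewrite /b_map size_rev_before_last_r size_map. Qed.

Theorem theorem3p7 :
  (forall w, L_Rect w -> L_Evil (b_map w)) /\
  (forall w, size (b_map w) = size w) /\
  (forall w, L_Rect w -> b_inv (b_map w) = w) /\
  (forall v, L_Evil v -> L_Rect (b_inv v) /\ b_map (b_inv v) = v).
Proof.
split=> [w /L_RectP [w_nil w_form]|].
  apply/L_EvilP; split; last exact: formE_b_map.
  by move/(congr1 size); rewrite size_b_map => /size0nil.
split; first exact: size_b_map.
split=> [w _|v /L_EvilP [v_nil v_form]]; first exact: b_mapK.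
split; last exact: b_invK.
apply/L_RectP; split; last exact: formR_b_inv.
by move=> v_eq; apply: v_nil; rewrite -(b_invK v) v_eq.
Qed.
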